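(* Let $G$ be a finite-dimensional Lie group with identity $e$ and Lie algebra $\mathfrak{g}=T_eG$, let $\nu_u: G\to\mathfrak{g}$ be a smooth kinematic control law (in the sense defined in the context), and let $\lambda\in\mathbb{R}_{>0}$. Endow the tangent bundle $TG\equiv G\times\mathfrak{g}$ with the binary operation $\star: TG\times TG\to TG$, $$h_1\star h_2 \triangleq \big(g_1g_2,\ \nu_1+\nu_2+\lambda\nu_u(g_1)+\lambda\nu_u(g_2)-\lambda\nu_u(g_1g_2)\big),$$ for all $h_1=(g_1,\nu_1),\ h_2=(g_2,\nu_2)\in TG$. Then $TG$ with the operation $\star$ is a Lie group, with (i) identity element $f\triangleq(e,0)\in TG$; (ii) inverse element $h^{-1}\triangleq(g^{-1},-\nu)\in TG$ for every $h=(g,\nu)\in TG$.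
   Context: The tangent bundle $TG$ is identified with $G\times\mathfrak{g}$ by left translation: $(g,\nu)$ corresponds to the tangent vector $g\cdot\nu\triangleq T_eL_g(\nu)\in T_gG$, where $L_g(h)=gh$. Let $V:G\to\mathbb{R}_{\ge 0}$ be an infinitely differentiable proper Morse function satisfying $V(g)>0$ for all $g\in G\setminus\{e\}$, and $\mathrm{d}V(g)=0$ and $V(g)=0\iff g=e$. Kinematic control law: a map $\nu_u:G\to\mathfrak{g}$ is a kinematic control law (relative to $V$) if, for the kinematics $\dot g(t)=g(t)\cdot\nu(t)$: (i) $\nu_u(e)=0$; (ii) $\nu_u(g^{-1})=-\nu_u(g)$ for all $g\in G$; (iii) $\langle \mathrm{d}V(g);\,-g\cdot\nu_u(g)\rangle<0$ for all $g\in G\setminus(\mathcal{O}_u\cup\{e\})$, where $\mathcal{O}_u\triangleq\{g\in G\setminus\{e\}\mid g\cdot\nu_u(g)=0\}$; (iv) $\langle \mathrm{d}V(g);\,-g\cdot\nu_u(g)\rangle=-y(g)V(g)$ for all $g\in\mathcal{U}$, where $y:\mathcal{U}\to\mathbb{R}_{>0}$ and $\mathcal{U}\subset G\setminus\mathcal{O}_u$ is a neighborhood of $e$. Here $\langle\cdot;\cdot\rangle$ denotes the pairing of a covector with a vector. *)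

(* Defs.v *)
From HB Require Import structures.
From mathcomp Require Import all_boot all_order all_algebra.
From mathcomp Require Import all_classical all_reals all_analysis.

Set Implicit Arguments.
Unset Strict Implicit.
Unset Printing Implicit Defensive.

Import Order.TTheory GRing.Theory Num.Theory.
Import numFieldNormedType.Exports.

Local Open Scope classical_set_scope.
Local Open Scope ring_scope.

Section Ck.
Context {R : realType}.
Implicit Types E F H : normedModType R.

(* U is meant to be open and E, F finite-dimensional: then continuity of
   x |-> 'd f x v for every v is continuity of the differential. *)
Fixpoint Ck_on {E F} (k : nat) (U : set E) (f : E -> F) : Prop :=
  if k is k'.+1 then
    (forall x, U x -> differentiable f x) /\
    (forall v, Ck_on k' U (fun x => 'd f x v))
  else forall x, U x -> {for x, continuous f}.

Definition smooth_on {E F} (U : set E) (f : E -> F) : Prop :=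
  forall k, Ck_on k U f.

Lemma diff_near_eq {E F} (f g : E -> F) x :
  (\forall y \near x, f y = g y) -> differentiable f x ->
  differentiable g x /\ 'd g x = 'd f x :> (E -> F).
Proof.
move=> fg df.
have dg : g \o shift x = cst (g x) + 'd f x +o_ 0 id.
  have fgx : f x = g x by exact: nbhs_singleton fg.
  apply/eqaddoP => e e0.
  have /eqaddoP/(_ e e0) H := diff_locally df.
  have : \forall y \near 0, f (y + x) = g (y + x).
    have /(_ _ fg) : (shift x @ (0 : E)) --> x.
      rewrite -[in X in _ --> X](add0r x); apply: cvgD; first exact: cvg_id.
      exact: cvg_cst.
    by [].
  apply: filterS2 H => y + E1; rewrite /= !fctE /= fgx.
  by rewrite E1.
have e1 : 'd g x = 'd f x :> (E -> F).
  by apply: diff_unique => //; exact: diff_continuous.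
split=> //; apply/diff_locallyP; rewrite e1; split => //.
exact: diff_continuous.
Qed.

Lemma diff_comp_at {E F H} (f : E -> F) (g : F -> H) x y : f x = y ->
  differentiable f x -> differentiable g y ->
  differentiable (g \o f) x /\
  'd (g \o f) x = 'd g y \o 'd f x :> (E -> H).
Proof.
move=> <- df dg; split; [exact: differentiable_comp|exact: diff_comp].
Qed.

Lemma Ck_on_eq {E F} k (U : set E) (f g : E -> F) : open U ->
  (forall x, U x -> f x = g x) -> Ck_on k U f -> Ck_on k U g.
Proof.
move=> oU; elim: k f g => [|k IH] f g fg /=.
  move=> cf x Ux; have fgn : \forall y \near x, f y = g y.
    by near do apply: fg; apply: open_nbhs_nbhs.
  have := cf _ Ux; rewrite /prop_for /continuous_at (fg _ Ux) => cfx.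
  by apply: cvg_trans cfx; apply: near_eq_cvg.
move=> [df Cf]; have H x (Ux : U x) : differentiable g x /\
    'd g x = 'd f x :> (E -> F).
  apply: diff_near_eq (df x Ux); near do apply: fg; exact: open_nbhs_nbhs.
split=> [x Ux|v]; first by have [] := H x Ux.
by apply: IH (Cf v) => x Ux; have [_ ->] := H x Ux.
Unshelve. all: by end_near. Qed.

Lemma Ck_onS {E F} k (U V : set E) (f : E -> F) : U `<=` V ->
  Ck_on k V f -> Ck_on k U f.
Proof.
move=> UV; elim: k f => [|k IH] f /=; first by move=> cf x /UV; exact: cf.
by move=> [df Cf]; split=> [x /UV|v]; [exact: df|exact: IH].
Qed.

Lemma Ck_on_cst {E F} k (U : set E) (c : F) : Ck_on k U (fun=> c).
Proof.
elim: k c => [|k IH] c /=; first by move=> x _; exact: cst_continuous.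
split=> [x _|v]; first exact: differentiable_cst.
suff -> : (fun x => 'd (fun=> c) x v) = fun=> 0 :> F by exact: IH.
by apply/funext => x; rewrite (diff_cst (c : F) x).
Qed.

Lemma Ck_onD {E F} k (U : set E) (f g : E -> F) : open U ->
  Ck_on k U f -> Ck_on k U g -> Ck_on k U (f \+ g).
Proof.
move=> oU; elim: k f g => [|k IH] f g /=.
  by move=> cf cg x Ux; apply: cvgD; [exact: cf|exact: cg].
move=> [df Cf] [dg Cg]; split=> [x Ux|v].
  by apply: differentiableD; [exact: df|exact: dg].
apply: (@Ck_on_eq _ _ k U ((fun x => 'd f x v) \+ (fun x => 'd g x v))) => //.
  by move=> x Ux; rewrite [in RHS](diffD (df x Ux) (dg x Ux)).
exact: IH.
Qed.

Lemma Ck_on_comp_lin {E F H} k (U : set F) (f : F -> H)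
    (L : {linear E -> F}) : open U -> continuous L ->
  Ck_on k U f -> Ck_on k (L @^-1` U) (f \o L).
Proof.
move=> oU cL; have oLU : open (L @^-1` U) by apply: open_comp => // x _; exact: cL.
elim: k f => [|k IH] f /=.
  move=> cf x Ux; apply: continuous_comp; [exact: cL|exact: cf].
move=> [df Cf]; have dL x := linear_differentiable x cL.
split=> [x Ux|v]; first by apply: differentiable_comp; [exact: dL|exact: df].
apply: (Ck_on_eq (f := (fun y => 'd f y (L v)) \o L)) => //.
  move=> x Ux; rewrite [in RHS](diff_comp (dL x) (df _ Ux)) /=.
  by rewrite (diff_lin x cL).
exact: IH.
Qed.

Lemma Ck_on_lin_comp {E F H} k (U : set E) (f : E -> F)
    (L : {linear F -> H}) : open U -> continuous L ->
  Ck_on k U f -> Ck_on k U (L \o f).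
Proof.
move=> oU cL; elim: k f => [|k IH] f /=.
  move=> cf x Ux; apply: continuous_comp; [exact: cf|exact: cL].
move=> [df Cf]; have dL x := linear_differentiable x cL.
split=> [x Ux|v]; first by apply: differentiable_comp; [exact: df|exact: dL].
apply: (Ck_on_eq (f := L \o (fun y => 'd f y v))) => //.
  move=> x Ux; rewrite [in RHS](diff_comp (df x Ux) (dL _)) /=.
  by rewrite (diff_lin _ cL).
exact: IH.
Qed.

Lemma Ck_on_id {E} k (U : set E) : Ck_on k U id.
Proof.
case: k => [|k] /=; first by move=> x _; exact: cvg_id.
split=> [x _|v]; first exact: (ex_diff (f := id)).
have -> : (fun x : E => 'd id x v) = fun=> v.
  by apply/funext => x; rewrite (diff_val (f := id)).
exact: Ck_on_cst.
Qed.

End Ck.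

Section topology_facts.

Lemma mx_continuous (T U : topologicalType) m n (f : T -> 'M[U]_(m, n)) t :
  (forall i j, {for t, continuous (fun s => f s i j)}) -> {for t, continuous f}.
Proof.
move=> cf A [P nP PA]; rewrite /nbhs /=.
have : \forall s \near t, forall ij : 'I_m * 'I_n, P ij.1 ij.2 (f s ij.1 ij.2).
  by apply: filter_forall => -[i j]; exact: (cf i j _ (nP i j)).
by apply: filterS => s Ps; apply: PA => i j; exact: (Ps (i, j)).
Qed.

Lemma pair_continuous (S T U : topologicalType) (f : S -> T) (g : S -> U) s :
  {for s, continuous f} -> {for s, continuous g} ->
  {for s, continuous (fun x => (f x, g x))}.
Proof.
move=> cf cg A [[P Q] /= [nP nQ] PQA].
have : nbhs s ((f @^-1` P) `&` (g @^-1` Q)).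
  by apply: filterI; [exact: cf|exact: cg].
by apply: filterS => x [/= Px Qx]; exact: PQA.
Qed.

Lemma cluster_continuous (S T : topologicalType) (f : S -> T) (p q : S) :
  continuous f -> cluster (nbhs p) q -> cluster (nbhs (f p)) (f q).
Proof.
move=> cf pq A B /cf nA /cf nB; have [s [As Bs]] := pq _ _ nA nB.
by exists (f s).
Qed.

Lemma hausdorff_prod (S T : topologicalType) : hausdorff_space S ->
  hausdorff_space T -> hausdorff_space (S * T)%type.
Proof.
move=> hS hT [p1 p2] [q1 q2] pq; congr pair.
  by apply: hS; apply: (@cluster_continuous _ _ fst) pq => x; exact: cvg_fst.
by apply: hT; apply: (@cluster_continuous _ _ snd) pq => x; exact: cvg_snd.
Qed.

Lemma second_countable_prod (S T : topologicalType) : @second_countable S ->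
  @second_countable T -> @second_countable (S * T)%type.
Proof.
move=> [A cA [oA bA]] [B cB [oB bB]].
exists ((fun UV => UV.1 `*` UV.2) @` (A `*` B)); last split.
- by apply: card_le_trans (card_image_le _ _) _; exact: countableX.
- move=> _ [[U V] [/= /oA oU /oB oV] <-]; rewrite openE => -[x y] [/= Ux Vy].
  by exists (U, V) => //; split; apply: open_nbhs_nbhs.
- move=> [x y] W [[P Q] /= [nP nQ] PQW].
  have [U [AU Ux] UP] := bA x _ nP; have [V [BV Vy] VQ] := bB y _ nQ.
  exists (U `*` V); first by split=> //; exists (U, V).
  by move=> [a b] [/= Ua Vb]; apply: PQW; split; [exact: UP|exact: VQ].
Qed.

Lemma second_countable_rV (R : realType) n : @second_countable 'rV[R]_n.
Proof.
pose B (qk : 'rV[rat]_n * nat) := ball (map_mx ratr qk.1 : 'rV[R]_n) qk.2.+1%:R^-1.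
exists (range B); last split.
- exact: card_le_trans (card_image_le _ _) (countableP _).
- by move=> _ [qk _ <-]; exact: ball_open.
- move=> x V /nbhs_ballP[e /= e0 xV].
  have e20 : 0 < e / 2 by rewrite divr_gt0.
  have [k _ /(_ _ (leqnn k)) ke] := near_infty_natSinv_lt (PosNum e20).
  have k0 : (0 : R) < k.+1%:R^-1 by rewrite invr_gt0.
  have qx (j : 'I_n) : exists q : rat, `|x ord0 j - ratr q| < k.+1%:R^-1.
    have xk : x ord0 j < x ord0 j + k.+1%:R^-1 by rewrite ltrDl.
    have [q] := rat_in_itvoo xk.
    rewrite in_itv /= => /andP[q1 q2]; exists q.
    by rewrite distrC ger0_norm ?subr_ge0 1?ltW// ltrBlDl.
  have [q qP] := choice qx; pose r := \row_j q j.
  have Bx : ball (map_mx ratr r : 'rV[R]_n) k.+1%:R^-1 x.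
    by split=> // i j; rewrite !mxE ord1 /ball /= distrC.
  exists (B (r, k)); first by split=> //; exists (r, k).
  move=> y By; apply: xV; rewrite (splitr e).
  apply: (@ball_triangle _ _ (map_mx ratr r : 'rV[R]_n)).
    by apply: ball_sym; apply: le_ball Bx; exact: ltW.
  by apply: le_ball By; exact: ltW.
Qed.

End topology_facts.

Record chart (R : realType) (n : nat) (M : topologicalType) := Chart {
  chart_dom : set M;
  coord :> M -> 'rV[R]_n;
  param : 'rV[R]_n -> M;
  chart_img := coord @` chart_dom;
  open_dom : open chart_dom;
  open_img : open chart_img;
  coordK : forall p, chart_dom p -> param (coord p) = p;
  coord_continuous_on : forall p, chart_dom p -> {for p, continuous coord};
  param_continuous_on : forall x, chart_img x -> {for x, continuous param}
}.

(* The atlas is a family of charts and need not be maximal; chart_at only names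
   a chart around each point. *)
HB.mixin Record isManifold (R : realType) (n : nat) M of Topological M := {
  atlas : Type;
  chart_of : atlas -> chart R n M;
  chart_at : M -> atlas;
  mem_chart_at : forall p, chart_dom (chart_of (chart_at p)) p;
  chart_compat : forall i j,
    smooth_on (chart_of i @` (chart_dom (chart_of i) `&` chart_dom (chart_of j)))
      (chart_of j \o param (chart_of i));
  manifold_hausdorff : hausdorff_space M;
  manifold_second_countable : @second_countable M
}.

#[short(type="manifoldType")]
HB.structure Definition Manifold (R : realType) (n : nat) :=
  {M of Topological M & isManifold R n M}.

Arguments chart_of {R n M} : rename.
Arguments chart_at {R n M} : rename.
Arguments atlas {R n} M : rename.

Section TransitionMaps.
Context {R : realType} {n : nat} {M : manifoldType R n}.
Implicit Types (p : M) (i j k : atlas M).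

Definition mdom i : set M := chart_dom (chart_of i).

Definition transition i j : 'rV[R]_n -> 'rV[R]_n :=
  chart_of j \o param (chart_of i).

Lemma open_chart_img i (U : set M) : open U -> U `<=` mdom i ->
  open (chart_of i @` U).
Proof.
move=> oU Ui; rewrite openE => _ [p Up <-].
have xi : chart_img (chart_of i) (chart_of i p) by exists p => //; exact: Ui.
have : \forall y \near chart_of i p, chart_img (chart_of i) y /\
    U (param (chart_of i) y).
  apply: filterI; first by apply: open_nbhs_nbhs; split=> //; exact: open_img.
  apply: (param_continuous_on xi).
  by rewrite coordK; [exact: open_nbhs_nbhs|exact: Ui].
apply: filterS => _ [[q iq <-]]; rewrite coordK// => Uq; by exists q.
Qed.

Lemma differentiable_transition i j p : mdom i p -> mdom j p ->
  differentiable (transition i j) (chart_of i p).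
Proof. by move=> ip jp; have [+ _] := chart_compat i j 1; apply; exists p. Qed.

Lemma near_chart_img i p (U : set M) : open U -> mdom i p -> U p ->
  \forall y \near chart_of i p, (chart_of i @` (mdom i `&` U)) y.
Proof.
move=> oU ip Up; apply: open_nbhs_nbhs; split; last by exists p.
by apply: open_chart_img; [apply: openI => //; exact: open_dom|exact: subIsetl].
Qed.

Lemma diff_transition_id i p : mdom i p ->
  'd (transition i i) (chart_of i p) = id :> ('rV[R]_n -> 'rV[R]_n).
Proof.
move=> ip; have dI : differentiable (@id 'rV[R]_n) (chart_of i p).
  exact: ex_diff.
have [|_ ->] := @diff_near_eq _ _ _ _ (transition i i) _ _ dI.
  have := near_chart_img openT ip I.
  by apply: filterS => _ [q [iq _] <-]; rewrite /transition /= coordK.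
exact: (diff_val (f := id)).
Qed.

Lemma diff_transition_comp i j k p : mdom i p -> mdom j p -> mdom k p ->
  'd (transition i k) (chart_of i p) =
  'd (transition j k) (chart_of j p) \o 'd (transition i j) (chart_of i p)
    :> ('rV[R]_n -> 'rV[R]_n).
Proof.
move=> ip jp kp; have dij := differentiable_transition ip jp.
have tip : transition i j (chart_of i p) = chart_of j p.
  by rewrite /transition /= coordK.
have djk := differentiable_transition jp kp.
have [dijk e1] := diff_comp_at tip dij djk.
have near_eq : \forall y \near chart_of i p,
    (transition j k \o transition i j) y = transition i k y.
  have := near_chart_img (open_dom (chart_of j)) ip jp.
  by apply: filterS => _ [q [iq jq] <-]; rewrite /transition /= !coordK.
have [_ e] := diff_near_eq near_eq dijk.
exact: (etrans e e1).
Qed.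

End TransitionMaps.

(* A tangent vector at p is the family of its components in all the charts
   around p, related by the differentials of the transition maps; it is padded
   with 0 at the charts that do not contain p. *)
Section Tangent.
Context {R : realType} {n : nat} {M : manifoldType R n}.
Implicit Types (p : M) (i j : atlas M).

Definition is_tangent p (v : atlas M -> 'rV[R]_n) : Prop :=
  (forall i, ~ mdom i p -> v i = 0) /\
  (forall i j, mdom i p -> mdom j p ->
     v j = 'd (transition i j) (chart_of i p) (v i)).

Definition tangent_pred p : {pred atlas M -> 'rV[R]_n} :=
  fun v => `[< is_tangent p v >].

Record tangent p := Tangent {
  components :> atlas M -> 'rV[R]_n;
  componentsP : components \in tangent_pred p
}.

HB.instance Definition _ p := [isSub for @components p].
HB.instance Definition _ p := [Choice of tangent p by <:].

Lemma tangent_submod_closed p : GRing.submod_closed (tangent_pred p).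
Proof.
split=> [|a u v /asboolP[u0 uE] /asboolP[v0 vE]]; apply/asboolP; split=> //.
- by move=> i j ip jp; rewrite linear0.
- by move=> i ip; rewrite !fctE u0// v0// scaler0 addr0.
- by move=> i j ip jp; rewrite !fctE linearP -uE// -vE.
Qed.

HB.instance Definition _ p :=
  GRing.isSubmodClosed.Build R (atlas M -> 'rV[R]_n) (tangent_pred p)
    (tangent_submod_closed p).
HB.instance Definition _ p := [SubChoice_isSubLmodule of tangent p by <:].

End Tangent.

Section TangentManifold.
Context {R : realType} {n : nat} {M : manifoldType R n}.
Implicit Types (p : M) (i j : atlas M) (x : 'rV[R]_n).

Lemma tangentE p (v : tangent p) i j : mdom i p -> mdom j p ->
  v j = 'd (transition i j) (chart_of i p) (v i).
Proof. by case: v => v /= /asboolP[_]; apply. Qed.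

Lemma tangent_eq p (u v : tangent p) i : mdom i p -> u i = v i -> u = v.
Proof.
move=> ip uv; apply/val_inj/funext => j /=; case: (pselect (mdom j p)) => jp.
  by rewrite (tangentE u ip jp) (tangentE v ip jp) uv.
case: u v {uv} => u /= /asboolP[+ _] [v /= /asboolP[+ _]].
by move=> -> // ->.
Qed.

Definition family_of p i x : atlas M -> 'rV[R]_n := fun j =>
  if `[< mdom j p >] then 'd (transition i j) (chart_of i p) x else 0.

Lemma family_ofP p i x : mdom i p -> family_of p i x \in tangent_pred p.
Proof.
move=> ip; apply/asboolP; split=> [j jp|j k jp kp]; rewrite /family_of.
  by case: asboolP.
rewrite !asboolT//; have := diff_transition_comp ip jp kp.
by move=> /(congr1 (@^~ x)).
Qed.

Definition tangent_of p x : tangent p :=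
  Tangent (family_ofP x (mem_chart_at p)).

Lemma tangent_ofK p : cancel (fun v : tangent p => v (chart_at p)) (tangent_of p).
Proof.
move=> v; apply: (tangent_eq (mem_chart_at p)) => /=.
rewrite /family_of asboolT; last exact: mem_chart_at.
by rewrite -tangentE//; exact: mem_chart_at.
Qed.

Lemma tangent_of_at p x i : mdom i p ->
  tangent_of p x i = 'd (transition (chart_at p) i) (chart_of (chart_at p) p) x.
Proof. by move=> ip; rewrite /= /family_of asboolT. Qed.

Lemma tangent_of_chart_at p x : tangent_of p x (chart_at p) = x.
Proof.
rewrite tangent_of_at; last exact: mem_chart_at.
by rewrite diff_transition_id//; exact: mem_chart_at.
Qed.

(* T_pM carries the topology and the smooth structure of a real vector space of
   dimension n: the components in one chart form a global linear chart. *)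
HB.instance Definition _ p := Topological.copy (tangent p)
  (initial_topology (fun v : tangent p => v (chart_at p))).

Definition tangent_coord p (v : tangent p) : 'rV[R]_n := v (chart_at p).

Lemma tangent_coord_continuous p : continuous (@tangent_coord p).
Proof. exact: (@initial_continuous (tangent p) _ (@tangent_coord p)). Qed.

Lemma tangent_of_continuous p : continuous (tangent_of p).
Proof.
apply/continuousP => _ [B oB <-].
rewrite (_ : _ @^-1` _ = B)//; apply/funext => x.
exact: (congr1 B (tangent_of_chart_at p x)).
Qed.

Lemma tangent_img p : @tangent_coord p @` setT = setT.
Proof.
apply/seteqP; split=> // x _; exists (tangent_of p x) => //.
exact: tangent_of_chart_at.
Qed.

Lemma tangent_open_img p : open (@tangent_coord p @` setT).
Proof. by rewrite tangent_img; exact: openT. Qed.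

Definition tangent_chart p : chart R n (tangent p) :=
  @Chart R n (tangent p) setT (@tangent_coord p) (tangent_of p) openT
    (@tangent_open_img p) (fun v _ => @tangent_ofK p v)
    (fun v _ => @tangent_coord_continuous p v)
    (fun x _ => @tangent_of_continuous p x).

Lemma tangent_chart_compat p (i j : unit) :
  smooth_on (tangent_chart p @` (setT `&` setT)) (tangent_chart p \o tangent_of p).
Proof.
rewrite setTI /= tangent_img (_ : _ \o _ = id); last first.
  by apply/funext => x; exact: tangent_of_chart_at.
by move=> k; exact: Ck_on_id.
Qed.

Lemma tangent_hausdorff p : hausdorff_space (tangent p).
Proof.
move=> u v uv; apply: (tangent_eq (mem_chart_at p)).
apply: (@norm_hausdorff _ 'rV[R]_n).
exact: (cluster_continuous (@tangent_coord_continuous p) uv).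
Qed.

Lemma tangent_second_countable p : @second_countable (tangent p).
Proof.
have [B cB [oB bB]] := second_countable_rV R n.
exists ((fun A => @tangent_coord p @^-1` A) @` B); last split.
- exact: card_le_trans (card_image_le _ _) cB.
- move=> _ [A /oB oA <-]; apply: open_comp => // v _.
  exact: tangent_coord_continuous.
- move=> v W; rewrite nbhsE => -[_ [[A oA <-] Av] AW].
  have [U [BU Uv] UA] := bB _ _ (open_nbhs_nbhs (conj oA Av)).
  exists (@tangent_coord p @^-1` U); first by split=> //; exists U.
  by move=> w /UA Aw; exact: AW.
Qed.

HB.instance Definition _ p := isManifold.Build R n (tangent p)
  (atlas := unit) (chart_of := fun=> tangent_chart p) (chart_at := fun=> tt)
  (fun=> I) (@tangent_chart_compat p) (@tangent_hausdorff p)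
  (@tangent_second_countable p).

End TangentManifold.

Section ProductManifold.
Context {R : realType} {m n : nat} {M : manifoldType R m} {N : manifoldType R n}.
Implicit Types (i : atlas M * atlas N).

Lemma row_mx_sum (a : 'rV[R]_m) (b : 'rV[R]_n) :
  row_mx a b = mulmxr (row_mx 1%:M 0) a + mulmxr (row_mx 0 1%:M) b.
Proof.
by rewrite /= !mul_mx_row !mulmx1 !mulmx0 add_row_mx addr0 add0r.
Qed.

Lemma row_mx_continuous : continuous
  (fun ab : 'rV[R]_m * 'rV[R]_n => row_mx ab.1 ab.2 : 'rV[R]_(m + n)).
Proof.
move=> ab; apply: mx_continuous => i j.
case: (split_ordP j) => k ->.
- have -> : (fun s : 'rV[R]_m * 'rV[R]_n => row_mx s.1 s.2 i (lshift n k)) =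
      (fun v : 'rV[R]_m => v i k) \o fst.
    by apply/funext => s; rewrite row_mxEl.
  by apply: continuous_comp; [exact: cvg_fst|exact: coord_continuous].
- have -> : (fun s : 'rV[R]_m * 'rV[R]_n => row_mx s.1 s.2 i (rshift m k)) =
      (fun v : 'rV[R]_n => v i k) \o snd.
    by apply/funext => s; rewrite row_mxEr.
  by apply: continuous_comp; [exact: cvg_snd|exact: coord_continuous].
Qed.

Lemma row_mx0_continuous :
  continuous (mulmxr (row_mx 1%:M 0) : 'rV[R]_m -> 'rV[R]_(m + n)).
Proof.
have -> : (mulmxr (row_mx 1%:M 0) : 'rV[R]_m -> 'rV[R]_(m + n)) =
    (fun ab : 'rV[R]_m * 'rV[R]_n => row_mx ab.1 ab.2) \o (fun a => (a, 0)).
  by apply/funext => a /=; rewrite mul_mx_row mulmx1 mulmx0.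
move=> a; apply: continuous_comp; last exact: row_mx_continuous.
by apply: pair_continuous => /=; [exact: cvg_id|exact: cst_continuous].
Qed.

Lemma row_0mx_continuous :
  continuous (mulmxr (row_mx 0 1%:M) : 'rV[R]_n -> 'rV[R]_(m + n)).
Proof.
have -> : (mulmxr (row_mx 0 1%:M) : 'rV[R]_n -> 'rV[R]_(m + n)) =
    (fun ab : 'rV[R]_m * 'rV[R]_n => row_mx ab.1 ab.2) \o (fun b => (0, b)).
  by apply/funext => a /=; rewrite mul_mx_row mulmx1 mulmx0.
move=> a; apply: continuous_comp; last exact: row_mx_continuous.
by apply: pair_continuous => /=; [exact: cst_continuous|exact: cvg_id].
Qed.

Definition prod_dom i : set (M * N) := mdom i.1 `*` mdom i.2.

Definition prod_coord i (p : M * N) : 'rV[R]_(m + n) :=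
  row_mx (chart_of i.1 p.1) (chart_of i.2 p.2).

Definition prod_param i (x : 'rV[R]_(m + n)) : M * N :=
  (param (chart_of i.1) (lsubmx x), param (chart_of i.2) (rsubmx x)).

Lemma prod_coord_image (A : set M) (B : set N) i :
  prod_coord i @` (A `*` B) =
  lsubmx @^-1` (chart_of i.1 @` A) `&` rsubmx @^-1` (chart_of i.2 @` B).
Proof.
apply/seteqP; split=> [_ [[p q] [/= Ap Bq] <-]|x [[p Ap px] [q Bq qx]]].
  by split; rewrite /prod_coord /= ?row_mxKl ?row_mxKr; [exists p|exists q].
by exists (p, q) => //; rewrite /prod_coord /= px qx hsubmxK.
Qed.

Lemma open_submx_preimage (A : set 'rV[R]_m) (B : set 'rV[R]_n) :
  open A -> open B ->
  open (lsubmx @^-1` A `&` rsubmx @^-1` B : set 'rV[R]_(m + n)).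
Proof.
move=> oA oB; apply: openI; apply: open_comp => // x _.
  exact: continuous_lsubmx.
exact: continuous_rsubmx.
Qed.

Lemma open_prod_dom i : open (prod_dom i).
Proof.
rewrite openE => -[p q] [/= ip iq]; exists (mdom i.1, mdom i.2) => //.
by split; apply: open_nbhs_nbhs; split=> //; exact: open_dom.
Qed.

Lemma open_prod_img i : open (prod_coord i @` prod_dom i).
Proof.
by rewrite prod_coord_image; apply: open_submx_preimage; exact: open_img.
Qed.

Lemma prod_coordK i p : prod_dom i p -> prod_param i (prod_coord i p) = p.
Proof.
case: p => p q [/= ip iq]; rewrite /prod_param /prod_coord /= row_mxKl row_mxKr.
by rewrite !coordK.
Qed.

Lemma prod_coord_continuous i p : prod_dom i p ->
  {for p, continuous (prod_coord i)}.
Proof.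
case: p => p q [/= ip iq].
apply: (@continuous_comp _ _ _
  (fun r : M * N => (chart_of i.1 r.1 : 'rV[R]_m, chart_of i.2 r.2 : 'rV[R]_n))
  (fun ab : 'rV[R]_m * 'rV[R]_n => row_mx ab.1 ab.2 : 'rV[R]_(m + n)));
  last exact: row_mx_continuous.
apply: pair_continuous => /=.
  apply: (@continuous_comp _ _ _ fst); first exact: cvg_fst.
  exact: coord_continuous_on.
apply: (@continuous_comp _ _ _ snd); first exact: cvg_snd.
exact: coord_continuous_on.
Qed.

Lemma prod_param_continuous i x : (prod_coord i @` prod_dom i) x ->
  {for x, continuous (prod_param i)}.
Proof.
rewrite prod_coord_image => -[/= xl xr]; apply: pair_continuous => /=.
  apply: (@continuous_comp _ _ _ lsubmx); first exact: continuous_lsubmx.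
  exact: param_continuous_on.
apply: (@continuous_comp _ _ _ rsubmx); first exact: continuous_rsubmx.
exact: param_continuous_on.
Qed.

Definition prod_chart i : chart R (m + n) (M * N)%type :=
  @Chart R (m + n) (M * N)%type (prod_dom i) (prod_coord i) (prod_param i)
    (@open_prod_dom i) (@open_prod_img i) (@prod_coordK i)
    (@prod_coord_continuous i) (@prod_param_continuous i).

Lemma prod_chart_compat i j :
  smooth_on (prod_chart i @` (prod_dom i `&` prod_dom j))
    (prod_chart j \o param (prod_chart i)).
Proof.
move=> k; pose U := chart_of i.1 @` (mdom i.1 `&` mdom j.1).
pose V := chart_of i.2 @` (mdom i.2 `&` mdom j.2).
have oU : open U.
  apply: open_chart_img; last exact: subIsetl.
  by apply: openI; exact: open_dom.
have oV : open V.
  apply: open_chart_img; last exact: subIsetl.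
  by apply: openI; exact: open_dom.
have -> : prod_chart i @` (prod_dom i `&` prod_dom j) =
    lsubmx @^-1` U `&` rsubmx @^-1` V.
  by rewrite /prod_dom -setXI -prod_coord_image.
have -> : prod_chart j \o param (prod_chart i) =
    (mulmxr (row_mx 1%:M 0) \o (transition i.1 j.1 \o lsubmx)) \+
    (mulmxr (row_mx 0 1%:M) \o (transition i.2 j.2 \o rsubmx)).
  by apply/funext => x; rewrite /= /prod_coord row_mx_sum.
have oUV := open_submx_preimage oU oV.
apply: Ck_onD => //.
- apply: Ck_on_lin_comp => //; first exact: row_mx0_continuous.
  apply: (Ck_onS (V := lsubmx @^-1` U)); first exact: subIsetl.
  by apply: Ck_on_comp_lin => //; [exact: continuous_lsubmx|exact: chart_compat].
- apply: Ck_on_lin_comp => //; first exact: row_0mx_continuous.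
  apply: (Ck_onS (V := rsubmx @^-1` V)); first exact: subIsetr.
  by apply: Ck_on_comp_lin => //; [exact: continuous_rsubmx|exact: chart_compat].
Qed.

HB.instance Definition _ := isManifold.Build R (m + n) (M * N)%type
  (atlas := (atlas M * atlas N)%type) (chart_of := prod_chart)
  (chart_at := fun p => (chart_at p.1, chart_at p.2))
  (fun p => conj (mem_chart_at p.1) (mem_chart_at p.2)) prod_chart_compat
  (hausdorff_prod (@manifold_hausdorff R m M) (@manifold_hausdorff R n N))
  (second_countable_prod (@manifold_second_countable R m M)
    (@manifold_second_countable R n N)).

End ProductManifold.

Section SmoothMaps.
Context {R : realType} {m n : nat} {M : manifoldType R m} {N : manifoldType R n}.

Definition smooth_map (f : M -> N) : Prop :=
  continuous f /\
  forall i j, smooth_on (chart_of i @` (mdom i `&` f @^-1` mdom j))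
    (chart_of j \o f \o param (chart_of i)).

Definition smooth_fun (f : M -> R) : Prop :=
  forall i, smooth_on (chart_img (chart_of i)) (f \o param (chart_of i)).

(* tangent_map and differential are computed in the charts picked by chart_at;
   for smooth f, tangent_mapE and differentialE give their values in any
   charts. *)
Definition tangent_map (f : M -> N) p (v : tangent p) : tangent (f p) :=
  let i := chart_at p in let j := chart_at (f p) in
  tangent_of (f p)
    ('d (chart_of j \o f \o param (chart_of i)) (chart_of i p) (v i)).

Definition differential (f : M -> R) p (v : tangent p) : R :=
  let i := chart_at p in 'd (f \o param (chart_of i)) (chart_of i p) (v i).

Lemma tangent_mapE (f : M -> N) p (v : tangent p) i j : smooth_map f ->
  mdom i p -> mdom j (f p) ->
  tangent_map f v j =
  'd (chart_of j \o f \o param (chart_of i)) (chart_of i p) (v i).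
Proof.
move=> [cf sf] ip jp; set i0 := chart_at p; set j0 := chart_at (f p).
have i0p : mdom i0 p := mem_chart_at p.
have j0p : mdom j0 (f p) := mem_chart_at (f p).
have fp : (chart_of j0 \o f \o param (chart_of i0)) (chart_of i0 p) =
    chart_of j0 (f p) by rewrite /= coordK.
have tp : transition i0 i (chart_of i0 p) = chart_of i p.
  by rewrite /transition /= coordK.
have df0 : differentiable (chart_of j0 \o f \o param (chart_of i0))
    (chart_of i0 p) by have [+ _] := sf i0 j0 1; apply; exists p.
have df : differentiable (chart_of j \o f \o param (chart_of i))
    (chart_of i p) by have [+ _] := sf i j 1; apply; exists p.
have [d1 e1] := diff_comp_at fp df0 (differentiable_transition j0p jp).
have [d2 e2] := diff_comp_at tp (differentiable_transition i0p ip) df.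
have near_eq : \forall y \near chart_of i0 p,
    ((chart_of j \o f \o param (chart_of i)) \o transition i0 i) y =
    (transition j0 j \o (chart_of j0 \o f \o param (chart_of i0))) y.
  have oU : open (mdom i `&` f @^-1` (mdom j0 `&` mdom j)).
    apply: openI; first exact: open_dom.
    by apply: open_comp; [move=> ? _; exact: cf|apply: openI; exact: open_dom].
  have := near_chart_img oU i0p (conj ip (conj j0p jp)).
  apply: filterS => _ [q [qi0 [qi [qj0 qj]]] <-].
  by rewrite /transition /= !coordK.
have [_ e3] := diff_near_eq near_eq d2.
have e := congr1 (fun h => h (v i0)) (etrans (esym e1) (etrans e3 e2)).
rewrite (tangentE v i0p ip); exact: (etrans (tangent_of_at _ jp) e).
Qed.

Lemma differentialE (f : M -> R) p (v : tangent p) i : smooth_fun f ->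
  mdom i p ->
  differential f v = 'd (f \o param (chart_of i)) (chart_of i p) (v i).
Proof.
move=> sf ip; set i0 := chart_at p; have i0p : mdom i0 p := mem_chart_at p.
have tp : transition i0 i (chart_of i0 p) = chart_of i p.
  by rewrite /transition /= coordK.
have df : differentiable (f \o param (chart_of i)) (chart_of i p).
  by have [+ _] := sf i 1; apply; exists p.
have [d2 e2] := diff_comp_at tp (differentiable_transition i0p ip) df.
have near_eq : \forall y \near chart_of i0 p,
    ((f \o param (chart_of i)) \o transition i0 i) y =
    (f \o param (chart_of i0)) y.
  have := near_chart_img (open_dom (chart_of i)) i0p ip.
  by apply: filterS => _ [q [qi0 qi] <-]; rewrite /transition /= !coordK.
have [_ e3] := diff_near_eq near_eq d2.
have e := congr1 (fun h => h (v i0)) (etrans e3 e2).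
by rewrite (tangentE v i0p ip); exact: e.
Qed.

Definition critical_point (f : M -> R) p : Prop :=
  forall v : tangent p, differential f v = 0.

Definition hessian (f : M -> R) i p : 'M[R]_m :=
  \matrix_(a, b) 'D_(delta_mx 0 a) ('D_(delta_mx 0 b) (f \o param (chart_of i)))
    (chart_of i p).

Definition morse (f : M -> R) : Prop :=
  smooth_fun f /\
  forall p i, critical_point f p -> mdom i p -> hessian f i p \in unitmx.

End SmoothMaps.

Definition proper_map (S T : topologicalType) (f : S -> T) : Prop :=
  continuous f /\ forall K, compact K -> compact (f @^-1` K).

(* The same axioms as lieGroupType below (see lieGroupP), for operations given
   explicitly. *)
Definition is_lie_group (R : realType) (n : nat) (G : manifoldType R n)
    (mul : G -> G -> G) (one : G) (inv : G -> G) : Prop :=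
  [/\ associative mul,
      left_id one mul /\ right_id one mul,
      left_inverse one inv mul /\ right_inverse one inv mul,
      smooth_map (fun gh : G * G => mul gh.1 gh.2)
    & smooth_map inv].

HB.mixin Record isLieGroup (R : realType) (n : nat) G
    of Manifold R n G & Group G := {
  mulg_smooth : smooth_map (fun gh : G * G => (gh.1 * gh.2)%g);
  invg_smooth : smooth_map (fun g : G => g^-1%g)
}.

#[short(type="lieGroupType")]
HB.structure Definition LieGroup (R : realType) (n : nat) :=
  {G of Manifold R n G & Group G & isLieGroup R n G}.

Notation lie_algebra G := (tangent (1%g : G)).

Section Kinematics.
Context {R : realType} {n : nat} {G : lieGroupType R n}.

Lemma lieGroupP : is_lie_group (fun g h : G => (g * h)%g) 1%g (fun g : G => g^-1%g).
Proof.
split.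
- exact: mulgA.
- by split; [exact: mul1g|exact: mulg1].
- by split; [exact: mulVg|exact: mulgV].
- exact: mulg_smooth.
- exact: invg_smooth.
Qed.

(* The differential of L_g at e lands in T_(g * e) G, hence the cast. *)
Definition left_translate (g : G) (nu : lie_algebra G) : tangent g :=
  ecast x (tangent x) (mulg1 g) (tangent_map (fun h : G => (g * h)%g) nu).

Record morse_potential (V : G -> R) : Prop := {
  potential_proper : proper_map V;
  potential_morse : morse V;
  potential_ge0 : forall g, 0 <= V g;
  potential_gt0 : forall g, g != 1%g -> 0 < V g;
  potential_critical : forall g, (critical_point V g /\ V g = 0) <-> g = 1%g
}.

Definition stationary_set (nu_u : G -> lie_algebra G) : set G :=
  [set g | g != 1%g /\ left_translate g (nu_u g) = 0].

Record kinematic_control_law (V : G -> R) (nu_u : G -> lie_algebra G) : Prop := {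
  control_law1 : nu_u 1%g = 0;
  control_lawV : forall g, nu_u g^-1%g = - nu_u g;
  control_law_decrease : forall g,
    (~` (stationary_set nu_u `|` [set 1%g])) g ->
    differential V (- left_translate g (nu_u g)) < 0;
  control_law_rate : exists (U : set G) (y : G -> R),
    [/\ nbhs 1%g U, U `<=` ~` stationary_set nu_u,
        forall g, U g -> 0 < y g
      & forall g, U g ->
          differential V (- left_translate g (nu_u g)) = - y g * V g]
}.

(* G * lie_algebra G stands for the tangent bundle TG: (g, nu) is the vector
   left_translate g nu of T_g G. *)
Definition star (nu_u : G -> lie_algebra G) (lambda : R)
    (h1 h2 : G * lie_algebra G) : G * lie_algebra G :=
  ((h1.1 * h2.1)%g,
   h1.2 + h2.2 + lambda *: nu_u h1.1 + lambda *: nu_u h2.1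
     - lambda *: nu_u (h1.1 * h2.1)%g).

End Kinematics.

(* Main.v *)
Require Import Defs.
From HB Require Import structures.
From mathcomp Require Import all_boot all_order all_algebra.
From mathcomp Require Import all_classical all_reals all_analysis.

Set Implicit Arguments.
Unset Strict Implicit.
Unset Printing Implicit Defensive.

Import GRing.Theory.
Import numFieldNormedType.Exports.

Local Open Scope classical_set_scope.
Local Open Scope ring_scope.

(** The operation [star] is the product of the direct product of [G] with the
    additive group of its Lie algebra, transported along the shear
      (g, nu) |-> (g, nu + lambda *: nu_u g),
    a bijection of [G * lie_algebra G]: the correction terms of [star] are
    exactly those for which the shear turns [star] into
    (g1, w1), (g2, w2) |-> (g1 g2, w1 + w2) ([shear_star]). Associativity is
    inherited from the direct product since the shear is injective. The
    transported unit and inverse are (e, - lambda *: nu_u e) and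
    (g^-1, - nu - lambda *: (nu_u g + nu_u g^-1)); they are (e, 0) and
    (g^-1, - nu) because a control law vanishes at e and is odd under inversion.

    Both [star] and its inverse are built from the projections of a product,
    the operations of [G], the map [nu_u] and the vector space operations of the
    Lie algebra, so their smoothness follows once smooth maps between manifolds
    are closed under composition ([smooth_map_comp]), pairing
    ([smooth_map_pair]) and linear combinations in a tangent space
    ([smooth_mapD], [smooth_mapZ]). In charts, composition rests on the C^k
    chain rule [Ck_on_comp], an induction on k in which the differential of a
    composite is written as a sum of products of C^k functions. *)

(** * Calculus of C^k maps *)

Section CkCalculus.
Context {R : realType}.
Implicit Types E F H : normedModType R.

Lemma Ck_onW {E F} k (U : set E) (f : E -> F) : Ck_on k.+1 U f -> Ck_on k U f.
Proof.
elim: k f => [|k IH] f [df Cf].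
  by move=> x /df; exact: differentiable_continuous.
by split=> // v; apply: IH; exact: Cf.
Qed.

(** Transition through an intermediate chart is only possible near each point,
    so C^k regularity of a composite of manifold maps is checked locally. *)
Lemma Ck_on_local {E F} k (U : set E) (f : E -> F) :
  (forall x, U x -> exists W : set E, W x /\ Ck_on k W f) -> Ck_on k U f.
Proof.
elim: k f => [|k IH] f loc /=.
  by move=> x /loc[W [Wx cf]]; exact: cf.
split=> [x /loc[W [Wx [df _]]]|v]; first exact: df.
by apply: IH => x /loc[W [Wx [_ Cf]]]; exists W; split => //; exact: Cf.
Qed.

Lemma Ck_on_sum {E F} k (U : set E) (I : Type) (r : seq I) (f : I -> E -> F) :
  open U -> (forall i, Ck_on k U (f i)) ->
  Ck_on k U (fun x => \sum_(i <- r) f i x).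
Proof.
move=> oU Cf; elim: r => [|i r IH].
  rewrite (_ : (fun _ => _) = fun=> 0); first exact: Ck_on_cst.
  by apply/funext => x; rewrite big_nil.
rewrite (_ : (fun _ => _) = f i \+ (fun x => \sum_(i <- r) f i x)).
  exact: Ck_onD.
by apply/funext => x; rewrite big_cons.
Qed.

(** Leibniz rule: the derivative of B(f, g) along v is B(f, dg v) + B(df v, g),
    which again has the form covered by the induction hypothesis. *)
Lemma Ck_on_bilinear {E F1 F2 H} (B : {bilinear F1 -> F2 -> H}) k (U : set E)
    (f : E -> F1) (g : E -> F2) :
  continuous (fun p => B p.1 p.2) -> open U ->
  Ck_on k U f -> Ck_on k U g -> Ck_on k U (fun x => B (f x) (g x)).
Proof.
move=> cB oU; elim: k f g => [|k IH] f g.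
  move=> cf cg x Ux.
  apply: (@continuous_comp _ _ _ (fun x => (f x, g x)) (fun p => B p.1 p.2)).
    by apply: pair_continuous; [exact: cf|exact: cg].
  exact: cB.
move=> Cf Cg; have [df Cdf] := Cf; have [dg Cdg] := Cg.
have dB p := differentiable_bilin p cB.
have dfg x : U x -> differentiable (fun y => (f y, g y)) x.
  by move=> Ux; apply: differentiable_pair; [exact: df|exact: dg].
split=> [x Ux|v].
  by apply: (@differentiable_comp _ _ _ _ (fun y => (f y, g y))
    (fun p => B p.1 p.2)); [exact: dfg|exact: dB].
apply: (@Ck_on_eq _ _ _ k U ((fun x => B (f x) ('d g x v)) \+
  (fun x => B ('d f x v) (g x)))) => //.
  move=> x Ux.
  have -> : (fun y => B (f y) (g y)) =
    (fun p => B p.1 p.2) \o (fun y => (f y, g y)) by [].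
  rewrite [in RHS](diff_comp (dfg x Ux) (dB _)) /=.
  by rewrite (diff_bilin _ cB) (diff_pair (df x Ux) (dg x Ux)).
apply: Ck_onD => //.
- exact: (IH _ _ (Ck_onW Cf) (Cdg v)).
- exact: (IH _ _ (Cdf v) (Ck_onW Cg)).
Qed.

Lemma scale_is_bilinear {H} : bilinear_for
  (GRing.Scale.Law.clone _ _ *:%R _) (GRing.Scale.Law.clone _ _ *:%R _)
  (@GRing.scale R H).
Proof.
split=> [u|a] x y z /=; first by rewrite scalerDl scalerA.
by rewrite scalerDr !scalerA mulrC.
Qed.

HB.instance Definition _ {H} := bilinear_isBilinear.Build R R H H _ _
  (@GRing.scale R H) scale_is_bilinear.

Lemma Ck_on_scale {E H} k (U : set E) (a : E -> R) (g : E -> H) : open U ->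
  Ck_on k U a -> Ck_on k U g -> Ck_on k U (fun x => a x *: g x).
Proof.
apply: (@Ck_on_bilinear E R H H (@GRing.scale R H)).
by move=> p; exact: scale_continuous.
Qed.

(** A named function, so that it can carry its linear structure. *)
Definition entry {m} (j : 'I_m) (u : 'rV[R]_m) : R := u 0 j.

Lemma entry_is_linear {m} (j : 'I_m) : linear (entry j).
Proof. by move=> a u v; rewrite /entry !mxE. Qed.

HB.instance Definition _ {m} (j : 'I_m) := GRing.isLinear.Build R 'rV[R]_m R _
  (entry j) (entry_is_linear j).

(** The derivative of g \o f along v at x is dg at f x applied to a vector that
    itself depends on x. The intermediate space being 'rV_m, expanding that
    vector in the canonical basis gives a sum of products of a scalar function
    and of a composite of f with a directional derivative of g along a fixed
    vector, to which the induction hypothesis applies. *)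
Lemma Ck_on_comp {E H} {m} k (U : set E) (V : set 'rV[R]_m)
    (f : E -> 'rV[R]_m) (g : 'rV[R]_m -> H) : open U ->
  (forall x, U x -> V (f x)) -> Ck_on k U f -> Ck_on k V g ->
  Ck_on k U (g \o f).
Proof.
move=> oU UV; elim: k f g UV => [|k IH] f g UV.
  move=> cf cg x Ux; apply: continuous_comp; first exact: cf.
  by apply: cg; exact: UV.
move=> Cf [dg Cdg]; have [df Cdf] := Cf.
split=> [x Ux|v].
  by apply: differentiable_comp; [exact: df|apply: dg; exact: UV].
apply: (@Ck_on_eq _ _ _ k U (fun x =>
  \sum_(j < m) ('d f x v) 0 j *: 'd g (f x) (delta_mx 0 j))) => //.
  move=> x Ux; rewrite [in RHS](diff_comp (df x Ux) (dg _ (UV x Ux))) /=.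
  rewrite [in RHS](row_sum_delta ('d f x v)) linear_sum.
  by apply: eq_bigr => j _; rewrite linearZ.
apply: Ck_on_sum => // j; apply: Ck_on_scale => //.
- apply: (@Ck_on_lin_comp _ _ _ _ _ _ _ (entry j)) => //.
    exact: coord_continuous.
  exact: Cdf.
- exact: (IH f (fun y => 'd g y (delta_mx 0 j)) UV (Ck_onW Cf) (Cdg _)).
Qed.

End CkCalculus.

(** * Smooth maps between manifolds *)

Section SmoothMapCalculus.
Context {R : realType}.

Lemma open_chart_preimage {m n} {M : manifoldType R m} {N : manifoldType R n}
    (f : M -> N) i (B : set N) : continuous f -> open B ->
  open (chart_of i @` (mdom i `&` f @^-1` B)).
Proof.
move=> cf oB; apply: open_chart_img; last exact: subIsetl.
apply: openI; first exact: open_dom.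
by apply: open_comp => // p _; exact: cf.
Qed.

(** Near a point p the composite is read through a chart c around f p, where it
    is the composite of the two coordinate expressions. *)
Lemma smooth_map_comp {l m n} {M : manifoldType R l} {N : manifoldType R m}
    {P : manifoldType R n} (f : M -> N) (g : N -> P) :
  smooth_map f -> smooth_map g -> smooth_map (g \o f).
Proof.
move=> [cf sf] [cg sg]; split=> [p|i j k].
  by apply: continuous_comp; [exact: cf|exact: cg].
apply: Ck_on_local => _ [p [ip /= jp] <-].
pose c := chart_at (f p); pose B := mdom c `&` g @^-1` mdom j.
have oB : open B.
  apply: openI; first exact: open_dom.
  by apply: open_comp; [move=> q _; exact: cg|exact: open_dom].
exists (chart_of i @` (mdom i `&` f @^-1` B)); split.
  by exists p => //; split=> //; split=> //; exact: mem_chart_at.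
have oW := open_chart_preimage (i := i) cf oB.
apply: (Ck_on_eq (f := (chart_of j \o g \o param (chart_of c)) \o
  (chart_of c \o f \o param (chart_of i)))) => //.
  by move=> _ [q [iq [cq jq]] <-] /=; rewrite !coordK.
apply: (Ck_on_comp (V := chart_of c @` B)) => //.
- by move=> _ [q [iq fq] <-]; exists (f q) => //=; rewrite coordK.
- apply: Ck_onS (sf i c k) => _ [q [iq [cq _]] <-].
  by exists q.
- exact: sg.
Qed.

(** In coordinates, the pair is the sum of the two coordinate expressions, each
    embedded linearly as a block of the concatenated row vector. *)
Lemma smooth_map_pair {l m n} {M : manifoldType R l} {N : manifoldType R m}
    {P : manifoldType R n} (f : M -> N) (g : M -> P) :
  smooth_map f -> smooth_map g -> smooth_map (fun p => (f p, g p)).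
Proof.
move=> [cf sf] [cg sg]; have cfg : continuous (fun p => (f p, g p)).
  by move=> p; apply: pair_continuous; [exact: cf|exact: cg].
split=> // i j k; have oW := open_chart_preimage (i := i) cfg (open_dom (chart_of j)).
apply: (Ck_on_eq (f :=
  (mulmxr (row_mx 1%:M 0) \o (chart_of j.1 \o f \o param (chart_of i))) \+
  (mulmxr (row_mx 0 1%:M) \o (chart_of j.2 \o g \o param (chart_of i))))) => //.
  by move=> x _; rewrite /= /prod_coord row_mx_sum.
apply: Ck_onD => //; apply: Ck_on_lin_comp => //.
- exact: row_mx0_continuous.
- by apply: Ck_onS (sf i j.1 k) => _ [q [iq [jq _]] <-]; exists q.
- exact: row_0mx_continuous.
- by apply: Ck_onS (sg i j.2 k) => _ [q [iq [_ jq]] <-]; exists q.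
Qed.

(** In coordinates, the first projection is a transition map of M precomposed
    with the linear extraction of the left block; a transition map, rather than
    the identity, because the chart on the target is arbitrary. *)
Lemma smooth_map_fst {m n} {M : manifoldType R m} {N : manifoldType R n} :
  smooth_map (fst : M * N -> M).
Proof.
have cfst : continuous (fst : M * N -> M) by move=> p; exact: cvg_fst.
split=> // i j k.
apply: (Ck_onS (V := lsubmx @^-1` (chart_of i.1 @` (mdom i.1 `&` mdom j)))).
  move=> _ [[p q] [[/= ip iq] jp] <-]; exists p => //=.
  by rewrite /prod_coord row_mxKl.
apply: (@Ck_on_comp_lin _ _ _ _ _ _ (transition i.1 j) lsubmx).
- apply: open_chart_img; last exact: subIsetl.
  by apply: openI; exact: open_dom.
- exact: continuous_lsubmx.
- exact: chart_compat.
Qed.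

Lemma smooth_map_snd {m n} {M : manifoldType R m} {N : manifoldType R n} :
  smooth_map (snd : M * N -> N).
Proof.
have csnd : continuous (snd : M * N -> N) by move=> p; exact: cvg_snd.
split=> // i j k.
apply: (Ck_onS (V := rsubmx @^-1` (chart_of i.2 @` (mdom i.2 `&` mdom j)))).
  move=> _ [[p q] [[/= ip iq] jq] <-]; exists q => //=.
  by rewrite /prod_coord row_mxKr.
apply: (@Ck_on_comp_lin _ _ _ _ _ _ (transition i.2 j) rsubmx).
- apply: open_chart_img; last exact: subIsetl.
  by apply: openI; exact: open_dom.
- exact: continuous_rsubmx.
- exact: chart_compat.
Qed.

Section TangentValued.
Context {l n : nat} {M : manifoldType R l} {N : manifoldType R n} {p : N}.
Implicit Types f g : M -> tangent p.

Lemma continuous_tangent f :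
  continuous (@tangent_coord _ _ _ p \o f) -> continuous f.
Proof. exact: continuous_comp_initial. Qed.

(** The chart of a tangent space is linear, so that sums (and, below, multiples)
    of maps become sums (and multiples) of their coordinate expressions. *)
Lemma smooth_mapD f g : smooth_map f -> smooth_map g ->
  smooth_map (fun q => f q + g q).
Proof.
move=> [cf sf] [cg sg]; have cfg : continuous (fun q => f q + g q).
  apply: continuous_tangent => q.
  by apply: (@cvgD _ _ _ _ _ (@tangent_coord _ _ _ p \o f)
    (@tangent_coord _ _ _ p \o g)); apply: continuous_comp;
    [exact: cf|exact: tangent_coord_continuous|exact: cg|
     exact: tangent_coord_continuous].
split=> // i j k.
have oW := open_chart_preimage (i := i) cfg (open_dom (chart_of j)).
apply: (Ck_on_eq (f :=
  (chart_of j \o f \o param (chart_of i)) \+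
  (chart_of j \o g \o param (chart_of i)))) => //.
by apply: Ck_onD => //; [exact: sf|exact: sg].
Qed.

Lemma smooth_mapZ (a : R) f : smooth_map f -> smooth_map (fun q => a *: f q).
Proof.
move=> [cf sf]; have caf : continuous (fun q => a *: f q).
  apply: continuous_tangent => q.
  apply: (@continuous_comp _ _ _ (@tangent_coord _ _ _ p \o f)
    (fun v : 'rV[R]_n => a *: v)); last exact: scaler_continuous.
  by apply: continuous_comp; [exact: cf|exact: tangent_coord_continuous].
split=> // i j k.
have oW := open_chart_preimage (i := i) caf (open_dom (chart_of j)).
apply: (@Ck_on_lin_comp _ _ _ _ _ _ (chart_of j \o f \o param (chart_of i))
  ( *:%R a)) => //; first exact: scaler_continuous.
exact: sf.
Qed.

Lemma smooth_mapN f : smooth_map f -> smooth_map (fun q => - f q).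
Proof.
have -> : (fun q => - f q) = fun q => -1 *: f q.
  by apply/funext => q; rewrite scaleN1r.
exact: smooth_mapZ.
Qed.

End TangentValued.

End SmoothMapCalculus.

(** * The group structure *)

Section TangentGroup.
Context {R : realType} {n : nat} {G : lieGroupType R n}.
Context (nu : G -> lie_algebra G) (lambda : R).
Hypotheses (nu1 : nu 1%g = 0) (nuV : forall g, nu g^-1%g = - nu g).

(** The isomorphism from [star] onto the direct product of [G] and the additive
    group of its Lie algebra. *)
Definition shear (h : G * lie_algebra G) : G * lie_algebra G :=
  (h.1, h.2 + lambda *: nu h.1).

Lemma shear_inj : injective shear.
Proof. by move=> [a u] [b v] /pair_equal_spec[/= <- /addIr ->]. Qed.

Lemma shear_star h1 h2 : shear (star nu lambda h1 h2) =
  (((shear h1).1 * (shear h2).1)%g, (shear h1).2 + (shear h2).2).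
Proof.
by rewrite /shear /star /= subrK [in RHS]addrACA addrA.
Qed.

Lemma starA : associative (star nu lambda).
Proof.
by move=> h1 h2 h3; apply: shear_inj; rewrite !shear_star /= mulgA addrA.
Qed.

Lemma star1h : left_id (1%g, 0) (star nu lambda).
Proof.
by move=> [a u]; rewrite /star /= mul1g add0r nu1 scaler0 addr0 addrK.
Qed.

Lemma starh1 : right_id (1%g, 0) (star nu lambda).
Proof.
by move=> [a u]; rewrite /star /= mulg1 addr0 nu1 scaler0 addr0 addrK.
Qed.

Lemma starVh : left_inverse (1%g, 0) (fun h => (h.1^-1%g, - h.2)) (star nu lambda).
Proof.
move=> [a u]; rewrite /star /= mulVg addNr add0r nu1 nuV scalerN addNr scaler0.
by rewrite subr0.
Qed.

Lemma starhV : right_inverse (1%g, 0) (fun h => (h.1^-1%g, - h.2)) (star nu lambda).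
Proof.
move=> [a u]; rewrite /star /= mulgV addrN add0r nu1 nuV scalerN addrN scaler0.
by rewrite subr0.
Qed.

Lemma star_smooth : smooth_map nu ->
  smooth_map (fun h => star nu lambda h.1 h.2).
Proof.
move=> snu.
pose T := (G * lie_algebra G)%type.
have s1 : smooth_map (fst \o fst : T * T -> G).
  by apply: smooth_map_comp; exact: smooth_map_fst.
have s2 : smooth_map (fst \o snd : T * T -> G).
  by apply: smooth_map_comp; [exact: smooth_map_snd|exact: smooth_map_fst].
have t1 : smooth_map (snd \o fst : T * T -> lie_algebra G).
  by apply: smooth_map_comp; [exact: smooth_map_fst|exact: smooth_map_snd].
have t2 : smooth_map (snd \o snd : T * T -> lie_algebra G).
  by apply: smooth_map_comp; exact: smooth_map_snd.
have s12 := smooth_map_comp (smooth_map_pair s1 s2) mulg_smooth.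
have snuZ (s : T * T -> G) (ss : smooth_map s) :
    smooth_map (fun h => lambda *: nu (s h)).
  exact: smooth_mapZ (smooth_map_comp ss snu).
apply: (smooth_map_pair s12); apply: smooth_mapD; last first.
  by apply: smooth_mapN; exact: snuZ s12.
by do 3?apply: smooth_mapD; [exact: t1|exact: t2|exact: snuZ s1|exact: snuZ s2].
Qed.

Lemma star_inv_smooth :
  smooth_map (fun h : G * lie_algebra G => (h.1^-1%g, - h.2)).
Proof.
apply: smooth_map_pair.
  exact: smooth_map_comp smooth_map_fst invg_smooth.
by apply: smooth_mapN; exact: smooth_map_snd.
Qed.

End TangentGroup.

Theorem lemma1 (R : realType) (n : nat) (G : lieGroupType R n) (V : G -> R)
    (nu_u : G -> lie_algebra G) (lambda : R) :
  morse_potential V ->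
  kinematic_control_law V nu_u ->
  smooth_map nu_u ->
  0 < lambda ->
  is_lie_group (star nu_u lambda)
    (1%g, 0 : lie_algebra G) (fun h : G * lie_algebra G => (h.1^-1%g, - h.2)).
Proof.
move=> _ [nu1 nuV _ _] snu _; split.
- exact: starA.
- by split; [exact: star1h|exact: starh1].
- by split; [exact: starVh|exact: starhV].
- exact: star_smooth.
- exact: star_inv_smooth.
Qed.
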